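(* Let $M$ be a finite simple binary matroid of positive rank $r$, and let $\pi=(\pi_1,\ldots,\pi_s)$ be a partition of $E(M)$ into nonempty blocks. The following are equivalent. (1) $\pi$ is nice. (2) The partition $\pi$ is independent, and no line of $M$ is contained in a single block of $\pi$. (3) After reordering, the blocks of $\pi$ are the successive differences $X_i\setminus X_{i-1}$ $(1\le i\le r)$ of a maximal chain of modular flats $\varnothing=X_0\subsetneq X_1\subsetneq\cdots\subsetneq X_r=E(M)$ of $M$, with $\operatorname{rk}_M(X_i)=i$.
   Context: A matroid is binary if it is representable over $\mathbb F_2$. $\operatorname{cl}_M$ and $\operatorname{rk}_M$ denote closure and rank. A line of $M$ is a flat of rank two. Two flats $X,Y$ of $M$ form a modular pair if $\operatorname{rk}_M(X)+\operatorname{rk}_M(Y)=\operatorname{rk}_M(X\cap Y)+\operatorname{rk}_M(\operatorname{cl}_M(X\cup Y))$; a flat is modular if it forms a modular pair with every flat of $M$. A partition $\pi=(\pi_1,\dots,\pi_s)$ of $E(M)$ is independent if every transversal $\{e_1,\dots,e_s\}$ with $e_i\in\pi_i$ is independent in $M$. It is nice if it is independent and, for every nonempty flat $F$, the partition of $F$ induced by $\pi$ (whose blocks are the nonempty sets $\pi_i\cap F$) has a singleton block. *)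

(* Defs.v *)
From HB Require Import structures.
From mathcomp Require Import all_boot all_order all_algebra.

Set Implicit Arguments.
Unset Strict Implicit.
Unset Printing Implicit Defensive.

(* The ground set E(M) is the whole finite type E, i.e. [set: E]. *)
Record matroid (E : finType) := Matroid {
  indep : pred {set E};
  indep0 : indep set0;
  indepS : forall I J : {set E}, I \subset J -> indep J -> indep I;
  indep_aug : forall I J : {set E}, indep I -> indep J -> #|I| < #|J| ->
    exists2 e, e \in J :\: I & indep (e |: I)
}.

Section MatroidTheory.

Variables (E : finType) (M : matroid E).

Definition rk (A : {set E}) : nat :=
  \max_(I : {set E} | (I \subset A) && indep M I) #|I|.

Definition cl (A : {set E}) : {set E} := [set e | rk (e |: A) == rk A].

Definition is_flat (F : {set E}) : bool := cl F == F.

Definition is_line (L : {set E}) : bool := is_flat L && (rk L == 2).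

Definition modular_pair (X Y : {set E}) : bool :=
  rk X + rk Y == rk (X :&: Y) + rk (cl (X :|: Y)).

Definition modular_flat (X : {set E}) : bool :=
  is_flat X && [forall (Y : {set E} | is_flat Y), modular_pair X Y].

(* No loops and no parallel pairs: no circuit has at most two elements. *)
Definition simple_matroid : Prop :=
  forall A : {set E}, #|A| <= 2 -> indep M A.

(* [free] is linear independence of a sequence of vectors with repetitions
   counted, so parallel elements are dependent even if v sends them to the
   same vector. *)
Definition representable (K : fieldType) : Prop :=
  exists (n : nat) (v : E -> 'rV[K]_n),
    forall A : {set E}, indep M A = free [seq v e | e <- enum A].

Definition binary : Prop := representable 'F_2.

(* [is_transversal T P setT] says that P is a partition of E and that T meets
   each block of P in exactly one element. *)
Definition independent_partition (P : {set {set E}}) : Prop :=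
  forall T : {set E}, is_transversal T P [set: E] -> indep M T.

Definition induced_partition (P : {set {set E}}) (F : {set E}) :
  {set {set E}} := [set B :&: F | B in P] :\ set0.

Definition nice (P : {set {set E}}) : Prop :=
  independent_partition P /\
  forall F : {set E}, is_flat F -> F != set0 ->
    exists2 B, B \in induced_partition P F & #|B| = 1.

Definition modular_chain (C : {set {set E}}) : bool :=
  [forall (F | F \in C), modular_flat F] &&
  [forall (F | F \in C), forall (G | G \in C), (F \subset G) || (G \subset F)].

(* X is indexed by nat; only X 0, ..., X r matter. *)
Definition maximal_modular_chain (r : nat) (X : nat -> {set E}) : Prop :=
  [/\ X 0 = set0, X r = [set: E],
      forall i, i < r -> X i \proper X i.+1,
      forall i, i <= r -> modular_flat (X i) &
      maxset modular_chain [set X (val i) | i : 'I_r.+1]].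

End MatroidTheory.

(* Main.v *)
Require Import Defs.
From HB Require Import structures.
From mathcomp Require Import all_boot all_order all_algebra.
From mathcomp Require Import zify.

(** Represent M by vectors over F_2 and color each element by its block.  Under
(2), two elements of one block sum to an element of another block, and no
nonempty set with distinct colors ("rainbow" set) sums to zero.

The key step is that three elements a, b, c of one block never sum to a rainbow
sum over a set T avoiding that block.  In a minimal counterexample, a + b and
a + c, say, share a color of T while y = b + c has another.  Add to both the
element of T of their common color, and repeat: the two paths share a color at
each step, always a new one of T and never that of y, so that T is infinite.

Hence a walk x, x + f, ..., adding at each step an element of the current block,
never returns to a block.  So, given a flat X that is a union of blocks, some
further block has all its differences in X; adjoining it gives a flat of rank one
more.  Iterating produces the chain: the rank of the intersection of a flat Y
with a stage is the number of blocks of the stage met by Y, which gives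
modularity.  Conversely, if X_i is the first term of a modular chain that meets
F, modularity of X_(i-1) forces the intersection to be a point. *)

Set Implicit Arguments.
Unset Strict Implicit.
Unset Printing Implicit Defensive.

Import GRing.Theory.

(** * Sums over rainbow sets in a group of exponent two *)

Section Rainbow.

Local Open Scope ring_scope.

Variables (E C : finType) (V : zmodType) (v : E -> V) (col : E -> C).

Definition rainbow (T : {set E}) : Prop := {in T &, injective col}.

Lemma rainbowS (S T : {set E}) : S \subset T -> rainbow T -> rainbow S.
Proof. by move=> /subsetP sST rT x y /sST xT /sST; apply: rT. Qed.

Lemma rainbowU1 e (T : {set E}) :
  rainbow T -> col e \notin col @: T -> rainbow (e |: T).
Proof.
move=> rT nT x y /setU1P[->|xT] /setU1P[->|yT] // eq_xy; last exact: rT.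
- by rewrite eq_xy imset_f in nT.
- by rewrite -eq_xy imset_f in nT.
Qed.

Lemma notin_imset_notin e (T : {set E}) : col e \notin col @: T -> e \notin T.
Proof. by apply: contra => eT; apply: imset_f. Qed.

Lemma imset_notinS c (S T : {set E}) :
  S \subset T -> c \notin col @: T -> c \notin col @: S.
Proof. by move=> sST; apply: contra; apply/subsetP/imsetS. Qed.

Lemma rainbow_transversal (Y : {set E}) :
  exists T : {set E}, [/\ T \subset Y, rainbow T & col @: T = col @: Y].
Proof.
(* The choice depends on the color of [e] alone, which makes [f @: Y] rainbow. The default is never
   reached for [e] in [Y], since [e] itself is a candidate. *)
pose f e := odflt e [pick x in Y | col x == col e].
have fP e : e \in Y -> f e \in Y /\ col (f e) = col e.
  rewrite /f; case: pickP => [x /andP[xY /eqP]|] //=.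
have f_col e e' : e \in Y -> col e = col e' -> f e = f e'.
  move=> eY eq_e; rewrite /f; under [X in _ = odflt _ X]eq_pick do rewrite -eq_e.
  by case: pickP => //= /(_ e); rewrite eY eqxx.
exists (f @: Y); split.
- by apply/subsetP=> _ /imsetP[e eY ->]; case: (fP _ eY).
- move=> _ _ /imsetP[e eY ->] /imsetP[e' eY' ->].
  by rewrite (fP _ eY).2 (fP _ eY').2; apply: f_col.
- apply/setP=> c; apply/imsetP/imsetP => [[_ /imsetP[e eY ->] ->]|[e eY ->]].
    by exists e; rewrite ?(fP _ eY).2.
  by exists (f e); rewrite ?imset_f ?(fP _ eY).2.
Qed.

Hypothesis add2 : forall x : V, x + x = 0.

Lemma add2K (x y : V) : y + x + x = y.
Proof. by rewrite -addrA add2 addr0. Qed.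

Lemma add2_eq (x y : V) : 0 + x + y = 0 -> x = y.
Proof. by rewrite add0r => /(congr1 (+%R^~ y)); rewrite add2K add0r. Qed.

(** Adds a known relation [A = B] to the goal, leaving an identity that [char2] can check. *)
Lemma add2_comb (A B x y : V) : A = B -> x + A = y + B -> x = y.
Proof. by move=> -> /addIr. Qed.

(* Decides equations of sums in a group of exponent two, by cancelling equal
   summands. *)
Ltac char2 := apply: add2_eq; rewrite ?addrA ?addr0;
  repeat match goal with
  | |- _ + ?x = 0 => progress (repeat first [rewrite (add2K x) | rewrite (addrAC _ x)])
  end; by rewrite ?add2.

(** The two halves of (2) in vector form: independence of the partition, and absence of a line
    inside a block, where over F_2 the third point of a line is the sum of the other two. *)
Hypothesis rainbow_sum : forall T : {set E},
  rainbow T -> T != set0 -> \sum_(e in T) v e != 0.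
Hypothesis third_point : forall e f : E, e != f -> col e = col f ->
  exists2 g, v g = v e + v f & col g != col e.

Lemma rainbow_sum1 e (T : {set E}) :
  rainbow T -> col e \notin col @: T -> v e + \sum_(x in T) v x = 0 -> False.
Proof.
move=> rT eT; rewrite -big_setU1 ?notin_imset_notin //=; apply/eqP.
apply: rainbow_sum; first exact: rainbowU1.
by apply/set0Pn; exists e; rewrite setU11.
Qed.

Lemma rainbow_sum2 e f (T : {set E}) :
  rainbow T -> col e \notin col @: T -> col f \notin col @: T ->
  col e != col f -> v e + v f + \sum_(x in T) v x = 0 -> False.
Proof.
move=> rT eT fT ef; rewrite -addrA -big_setU1 ?notin_imset_notin //=.
apply: rainbow_sum1; first exact: rainbowU1.
by rewrite imsetU1 in_setU1 negb_or ef.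
Qed.

(** * Short relations: lines, and three elements of one block *)

Lemma rainbow_inj : injective v.
Proof.
move=> e f eq_v; apply/eqP; apply: contraT => ef.
have r0 : rainbow set0 by move=> ? ?; rewrite inE.
have n0 c : c \notin col @: set0 by rewrite imset0 inE.
have [/(third_point ef)[g vg _]|cef] := eqVneq (col e) (col f).
  by case: (rainbow_sum1 (e := g) r0 (n0 _)); rewrite big_set0 vg eq_v addr0 add2.
by case: (rainbow_sum2 r0 (n0 _) (n0 _) cef); rewrite big_set0 eq_v addr0 add2.
Qed.

(** Three different colors would give a rainbow set with sum zero. Two equal colors make the
    remaining element the third point of their line, which lies outside their block. *)
Lemma line_two_colors p q y : v p + v q + v y = 0 ->
  [\/ col p = col q /\ col y != col p, col p = col y /\ col q != col p
    | col q = col y /\ col p != col q].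
Proof.
move=> sum0.
have r0 : rainbow set0 by move=> ? ?; rewrite inE.
have n0 c : c \notin col @: set0 by rewrite imset0 inE.
have nz e : v e != 0.
  apply: contraT; rewrite negbK => /eqP ve0.
  by case: (rainbow_sum1 (e := e) r0 (n0 _)); rewrite ve0 big_set0 addr0.
have third a b c : v a + v b = v c -> col a = col b -> col c != col a.
  move=> abc cab; have [eab|] := eqVneq a b.
    by have := nz c; rewrite -abc eab add2 eqxx.
  by move=> /third_point /(_ cab)[g]; rewrite abc => /rainbow_inj->.
have [cpq|cpq] := eqVneq (col p) (col q).
  by constructor 1; split=> //; apply: (third _ q) => //; apply: (add2_comb sum0); char2.
have [cpy|cpy] := eqVneq (col p) (col y).
  by constructor 2; split=> //; apply: (third _ y) => //; apply: (add2_comb sum0); char2.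
have [cqy|cqy] := eqVneq (col q) (col y).
  by constructor 3.
case: (@rainbow_sum2 p q [set y]).
- by move=> ? ? /set1P-> /set1P->.
- by rewrite imset_set1 inE.
- by rewrite imset_set1 inE.
- by [].
- by rewrite big_set1.
Qed.

(* [W] is the visited part of the transversal [W :|: R]; the points
   [a + b + \sum_W] and [a + c + \sum_W] run through the same colors, and never
   through the color of [y = b + c], so that [R] is never exhausted. *)
Lemma parallel_paths (n : nat) (a b c y p q : E) (W R : {set E}) :
  (forall (a b c : E) (T : {set E}), (#|T| < n)%N -> rainbow T ->
    col a = col b -> col a = col c -> col a \notin col @: T ->
    v a + v b + v c = \sum_(x in T) v x -> False) ->
  [disjoint W & R] -> rainbow (W :|: R) -> #|W :|: R| = n ->
  col a = col b -> col a = col c -> col a \notin col @: (W :|: R) ->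
  v a + v b + v c = \sum_(x in W) v x + \sum_(x in R) v x ->
  v y = v b + v c ->
  v p = v a + v b + \sum_(x in W) v x ->
  v q = v a + v c + \sum_(x in W) v x ->
  col y \in col @: R -> col p \in col @: R ->
  col p = col q -> col y != col p -> False.
Proof.
move=> IH; have [m leRm] := ubnP #|R|.
elim: m => // m IHm in W R p q leRm *.
move=> dWR rWR cardT cab cac caT rel vy vp vq yR pR cpq cyp.
have [g gR cpg] := imsetP pR.
pose W' := g |: W; pose R' := R :\ g.
have gW : g \notin W by rewrite (disjointFl dWR).
have sumW' : \sum_(x in W') v x = v g + \sum_(x in W) v x by rewrite big_setU1.
have sumR : \sum_(x in R) v x = v g + \sum_(x in R') v x by rewrite (big_setD1 g).
have eqT : W' :|: R' = W :|: R 
  by apply/setP=> x; rewrite !inE; case: eqVneq => [->|]; rewrite ?gR ?orbT.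
have dWR' : [disjoint W' & R'].
  apply/pred0P=> x; rewrite /= !inE; case: eqVneq => //= _.
  by apply/andP=> [[/(disjointFr dWR)->]].
have rW' : rainbow W' by apply: rainbowS rWR; rewrite -eqT subsetUl.
have rR' : rainbow R' by apply: rainbowS rWR; rewrite -eqT subsetUr.
have aW' : col a \notin col @: W' by apply: imset_notinS caT; rewrite -eqT subsetUl.
have aR' : col a \notin col @: R' by apply: imset_notinS caT; rewrite -eqT subsetUr.
(* The color of [y] differs from that of [g], so [h] survives in [R']. Hence [W'] is a proper part
   of the transversal, small enough for [IH]. *)
have [h hR cyh] := imsetP yR.
have hR' : h \in R' by rewrite !inE hR andbT; apply: contraNneq cyp => eq_hg; rewrite cyh eq_hg cpg.
have cardW' : (#|W'| < n)%N.
  rewrite -cardT -eqT; apply/proper_card/properP; split; first exact: subsetUl.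
  by exists h; [rewrite inE hR' orbT | rewrite (disjointFl dWR')].
have W'0 : (0 < #|W'|)%N by rewrite cardsU1 gW.
have ltR : (#|R'| < #|R|)%N by rewrite [#|R|](cardsD1 g) gR.
clearbody W' R'.
(* The next point of a path is the third point on the line of [p'] and [g]. Written over [W'], it
   cannot have the color of [a], by [IH]; written over [R'], it must then have a color of [R']. *)
have step b' c' p' : col a = col b' -> col a = col c' -> col p' = col g ->
    v a + v b' + v c' = \sum_(x in W) v x + \sum_(x in R) v x ->
    v p' = v a + v b' + \sum_(x in W) v x ->
  exists p1, [/\ v p1 = v a + v b' + \sum_(x in W') v x,
    v p1 = v c' + \sum_(x in R') v x & col p1 \in col @: R'].
  move=> cab' cac' cp' rel' vp'.
  have p'g : p' != g.
    apply/eqP => eq_g; apply: (@rainbow_sum1 c' R') => //; first by rewrite -cac'.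
    apply: (add2_comb rel'); rewrite sumR -eq_g vp'; char2.
  have [p1 vp1 _] := third_point p'g cp'.
  have vp1W : v p1 = v a + v b' + \sum_(x in W') v x by rewrite vp1 vp' sumW'; char2.
  have vp1R : v p1 = v c' + \sum_(x in R') v x.
    apply: (add2_comb rel'); rewrite sumR vp1 vp'; char2.
  exists p1; split=> //; apply: contraT => p1R; exfalso.
  have [ca1|ca1] := eqVneq (col a) (col p1).
    apply: (IH a b' p1 W') => //; rewrite vp1W; char2.
  apply: (@rainbow_sum2 p1 c' R') => //; first by rewrite -cac'.
    by rewrite -cac' eq_sym.
  rewrite vp1R; char2.
have [p' [vp' vp'R p'R]] := step b c p cab cac cpg rel vp.
have [|q' [vq' vq'R q'R]] := step c b q cac cab (etrans (esym cpq) cpg) _ vq.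
  by rewrite -rel; char2.
(* if a path enters the color of [y], then closing it through [y] and [h]
   gives a shorter transversal *)
have avoid b' p1 q1 : col a = col b' ->
    v q1 = v b' + \sum_(x in R') v x -> v p1 + v q1 + v y = 0 -> col p1 = col y -> False.
  move=> cab' vq1 sum0 cp1y.
  apply: (IH p1 y h (b' |: (R' :\ h))) => //.
  - rewrite -cardT -eqT [#|W' :|: R'|]cardsU disjoint_setI0 // cards0 subn0.
    rewrite cardsU1 [#|R'|](cardsD1 h) hR'.
    by rewrite addnA ltn_add2r addn1 ltnS (leq_trans (leq_b1 _)).
  - apply: rainbowU1; first by apply: rainbowS rR'; apply: subD1set.
    by rewrite -cab'; apply: imset_notinS aR'; apply: subD1set.
  - by rewrite cp1y.
  - rewrite cp1y cyh imsetU1 in_setU1 negb_or -cab'.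
    apply/andP; split; first by apply: contraNneq aR' => <-; apply: imset_f.
    apply/imsetP=> [[x]] /setD1P[xh xR'] /rR' eq_hx.
    by rewrite eq_hx ?eqxx in xh.
  rewrite big_setU1; last first.
    apply: notin_imset_notin; rewrite -cab'; apply: imset_notinS aR'; apply: subD1set.
  apply: (add2_comb sum0); rewrite /= vq1 (big_setD1 h) //=; char2.
have sum0 : v p' + v q' + v y = 0 by rewrite vp' vq' vy; char2.
(* Exactly two of [p'], [q'], [y] agree in color: either the paths still run in parallel, or one of
   them has entered the color of [y]. *)
case: (line_two_colors sum0) => [[eq_pq neq_y]|[eq_py _]|[eq_qy _]].
- apply: (IHm W' R' p' q') => //; rewrite ?eqT //.
  + exact: leq_trans ltR leRm.
  + by rewrite rel sumW' sumR; char2.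
  + by rewrite cyh imset_f.
- by apply: (avoid b p' q').
- by apply: (avoid c q' p') => //; rewrite (addrC (v q')).
Qed.

(** Each pairwise sum equals the third element plus the sum over [T], which forces its color into
    [T]. Two of the three pairwise sums share a color, and [parallel_paths] starts from them with
    nothing visited. *)
Lemma no_triple (a b c : E) (T : {set E}) :
  rainbow T -> col a = col b -> col a = col c -> col a \notin col @: T ->
  v a + v b + v c = \sum_(x in T) v x -> False.
Proof.
have [n leTn] := ubnP #|T|; elim: n => // n IHn in a b c T leTn *.
move=> rT cab cac caT rel.
have neq a' b' c' : col a = col c' -> v a' + v b' + v c' = \sum_(x in T) v x -> a' != b'.
  move=> cac' rel'; apply/eqP=> eq_ab; apply: (@rainbow_sum1 c' T) => //.
    by rewrite -cac'.
  by apply: (add2_comb rel'); rewrite eq_ab; char2.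
have sumT a' b' c' p : col a = col c' -> v a' + v b' + v c' = \sum_(x in T) v x ->
    col p != col a -> v p = v a' + v b' -> col p \in col @: T.
  move=> cac' rel' cpa vp; apply: contraT => pT; exfalso.
  apply: (@rainbow_sum2 p c' T) => //; rewrite -?cac' //.
  by rewrite vp rel' add2.
have relb : v a + v c + v b = \sum_(x in T) v x by rewrite -rel; char2.
have rela : v b + v c + v a = \sum_(x in T) v x by rewrite -rel; char2.
have [p vp cpa] := third_point (neq _ _ _ cac rel) cab.
have [q vq cqa] := third_point (neq _ _ _ cab relb) cac.
have [y vy cyb] := third_point (neq _ _ _ erefl rela) (etrans (esym cab) cac).
rewrite -cab in cyb.
have pT : col p \in col @: T by apply: (sumT a b c).
have qT : col q \in col @: T by apply: (sumT a c b).
have yT : col y \in col @: T by apply: (sumT b c a).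
have paths a' b' c' y' p' q' : col a = col a' -> col a = col b' -> col a = col c' ->
    v a' + v b' + v c' = \sum_(x in T) v x ->
    v y' = v b' + v c' -> v p' = v a' + v b' -> v q' = v a' + v c' ->
    col y' \in col @: T -> col p' \in col @: T -> col p' = col q' -> col y' != col p' -> False.
  move=> caa' cab' cac' rel' vy' vp' vq' y'T p'T cpq cyp.
  apply: (@parallel_paths #|T| a' b' c' y' p' q' set0 T) => //;
    rewrite ?set0U ?big_set0 ?addr0 ?add0r ?disjoints0 // -?caa' //.
  - by move=> a2 b2 c2 S ltST; apply: IHn; lia.
  - by rewrite -setI_eq0 set0I.
have sum0 : v p + v q + v y = 0 by rewrite vp vq vy; char2.
(* The element common to the two pairwise sums of equal color takes the role of [a']. *)
case: (line_two_colors sum0) => [[cpq cyp]|[cpy cqp]|[cqy cpq]].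
- exact: (paths a b c y p q).
- by apply: (paths b a c q p y) => //; rewrite ?vp // -?relb; char2.
- by apply: (paths c a b p q y) => //; rewrite ?vq ?vy -?rel // 1?eq_sym; try char2; rewrite -cqy.
Qed.

(** * Adjoining a further block to a union of blocks *)

Definition addable (X : {set E}) (e : E) : bool :=
  (e \notin X) && [forall f, forall f',
    [&& col f == col e, col f' == col e & f != f'] ==>
    [exists g in X, v g == v f + v f']].

(** Otherwise a walk outside [X] could always be continued, meeting more colors than there are
    elements. *)
Lemma exists_addable (X : {set E}) :
  (forall e f, e \in X -> col e = col f -> f \in X) ->
  (forall e f g, e \in X -> f \in X -> v g = v e + v f -> g \in X) ->
  X != setT -> exists e, addable X e.
Proof.
move=> satX lineX XT; apply/existsP; apply: contraT; rewrite negb_exists => /forallP none.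
(* A failing pair [f], [f'] in the block of [e] may avoid [e]. Then [e + f] and [e + f'] are not
   both in [X], since they sum to [f + f'] and [X] is closed under sums. *)
have next e : e \notin X -> exists f x,
    [/\ e != f, col f = col e, v x = v e + v f & x \notin X].
  move=> eX; have := none e; rewrite /addable eX => /forallPn[f /forallPn[f']].
  rewrite negb_imply negb_exists => /andP[/and3P[/eqP cfe /eqP cfe' neq] /forallP no].
  have noX g : v g = v f + v f' -> g \notin X.
    by move=> vg; have := no g; rewrite vg eqxx andbT.
  have [ef|ef] := eqVneq e f.
    subst f; have [g vg _] := third_point neq (esym cfe').
    by exists f', g; split=> //; apply: noX.
  have [ef'|ef'] := eqVneq e f'.
    subst f'; have [|g vg _] := third_point ef; first by rewrite cfe.
    by exists f, g; split=> //; apply: noX; rewrite vg addrC.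
  have [|h vh _] := third_point ef; first by rewrite cfe.
  have [hX|hX] := boolP (h \in X); last by exists f, h.
  have [|h' vh' _] := third_point ef'; first by rewrite cfe'.
  have [hX'|hX'] := boolP (h' \in X); last by exists f', h'.
  have [|g vg _] := third_point neq; first by rewrite cfe.
  have := noX g vg; rewrite (lineX h h' g) // vg vh vh'; char2.
(* [x] is the current end of a path that has used the elements of [T]; it is a
   sum along the path from any earlier block, so by [no_triple] it cannot
   return to that block. *)
have path k : exists (T : {set E}) x, [/\ rainbow T, #|T| = k, col x \notin col @: T, x \notin X &
    forall u, u \in T -> exists w (W : {set E}),
      [/\ W \subset T, u \notin W, col w = col u & v x = v w + v u + \sum_(z in W) v z]].
  elim: k => [|k [T [x [rT cT xT xX inv]]]].
    have /subsetPn[x _ xX] : ~~ ([set: E] \subset X) by rewrite subTset.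
    exists set0, x; rewrite cards0 imset0 inE; by split=> // [? ?|u]; rewrite inE.
  have [f [x' [xf cfx vx' x'X]]] := next x xX.
  have fT : col f \notin col @: T by rewrite cfx.
  have cx'x : col x' != col x.
    by have [g] := third_point xf (esym cfx); rewrite -vx' => /rainbow_inj->.
  exists (f |: T), x'; split=> //.
  - exact: rainbowU1.
  - by rewrite cardsU1 notin_imset_notin ?cT.
  - apply/imsetP=> [[u /setU1P[->|uT] cx'u]]; first by rewrite cx'u cfx eqxx in cx'x.
    have [w [W [sWT uW cwu vx]]] := inv u uT.
    have fW := imset_notinS sWT fT.
    apply: (@no_triple w u x' (f |: W)) => //.
    + exact: rainbowU1 (rainbowS sWT rT) fW.
    + by rewrite cx'u.
    + rewrite cwu imsetU1 in_setU1 negb_or; apply/andP; split.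
        by apply: contraNneq fT => <-; apply: imset_f.
      apply/imsetP=> [[z zW]] /(rT _ _ uT (subsetP sWT _ zW)) eq_uz.
      by rewrite eq_uz zW in uW.
    + by rewrite big_setU1 ?notin_imset_notin //= vx' vx; char2.
  - move=> u /setU1P[->|uT].
      by exists x, set0; rewrite sub0set inE big_set0 addr0.
    have [w [W [sWT uW cwu vx]]] := inv u uT.
    have fW := imset_notinS sWT fT.
    exists w, (f |: W); split=> //.
    + exact: setUS.
    + by rewrite in_setU1 negb_or uW andbT; apply: contraNneq fT => <-; apply: imset_f.
    + by rewrite big_setU1 ?notin_imset_notin //= vx' vx; char2.
have [T [x [_ cT _ _ _]]] := path #|E|.+1.
by have := max_card (mem T); rewrite cT ltnn.
Qed.

End Rainbow.

(** * Rank, closure and flats in terms of spans *)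

Section Representation.

Local Open Scope ring_scope.

Variables (E : finType) (M : matroid E) (K : fieldType) (V : vectType K).
Variable v : E -> V.
Hypothesis indep_free : forall A : {set E}, indep M A = free [seq v e | e <- enum A].

Definition vspan (A : {set E}) : {vspace V} := <<[seq v e | e <- enum A]>>%VS.

Lemma vspan_subP (A : {set E}) (U : {vspace V}) :
  reflect {in A, forall e, v e \in U} (vspan A <= U)%VS.
Proof.
apply: (iffP span_subvP) => [sub e eA|sub _ /mapP[e eA ->]].
  by apply/sub/map_f; rewrite mem_enum.
by apply: sub; rewrite mem_enum in eA.
Qed.

Lemma mem_vspan e (A : {set E}) : e \in A -> v e \in vspan A.
Proof. by move: e; apply/vspan_subP. Qed.

Lemma vspanS (A B : {set E}) : A \subset B -> (vspan A <= vspan B)%VS.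
Proof. by move=> /subsetP sAB; apply/vspan_subP=> e /sAB; apply: mem_vspan. Qed.

Lemma vspan0 : vspan set0 = 0%VS.
Proof. by rewrite /vspan enum_set0 span_nil. Qed.

Lemma vspanU (A B : {set E}) : vspan (A :|: B) = (vspan A + vspan B)%VS.
Proof.
apply/eqP; rewrite eqEsubv subv_add !vspanS ?subsetUl ?subsetUr // !andbT.
apply/vspan_subP=> e /setUP[] eS.
  by apply: subvP (addvSl _ _) _ (mem_vspan eS).
by apply: subvP (addvSr _ _) _ (mem_vspan eS).
Qed.

Lemma vspan1 e : vspan [set e] = <[v e]>%VS.
Proof. by rewrite /vspan enum_set1 span_seq1. Qed.

Lemma dim_vspanU1 e (A : {set E}) :
  \dim (vspan (e |: A)) = ((v e \notin vspan A) + \dim (vspan A))%N.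
Proof.
have sub : (vspan A <= vspan (e |: A))%VS by rewrite vspanS ?subsetUr.
have := dimv_leqif_sup sub; rewrite vspanU vspan1 subv_add subvv andbT -memvE.
have [eA|eA] /= := boolP (v e \in vspan A); first by case=> _ /eqP <-.
move=> [le neq]; apply/eqP; rewrite eqn_leq; apply/andP; split.
  by apply: leq_trans (dimv_add_leqif _ _).1 _; rewrite leq_add2r dim_vline leq_b1.
by rewrite ltn_neqAle neq le.
Qed.

Lemma indepE (A : {set E}) : indep M A = (\dim (vspan A) == #|A|).
Proof. by rewrite indep_free /free size_map -cardE. Qed.

Lemma indepU1 e (A : {set E}) : indep M A -> v e \notin vspan A -> indep M (e |: A).
Proof.
rewrite !indepE dim_vspanU1 => /eqP-> eA.
by rewrite eA cardsU1; case: (boolP (e \in A)) => // /mem_vspan; rewrite (negPf eA).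
Qed.

(** A largest independent subset of [A] spans [A], since an element outside its span could be
    adjoined. *)
Lemma rk_dim (A : {set E}) : rk M A = \dim (vspan A).
Proof.
apply/eqP; rewrite eqn_leq; apply/andP; split.
  by apply/bigmax_leqP=> I /andP[IA]; rewrite indepE => /eqP<-; apply/dimvS/vspanS.
have [I /andP[IA indI] maxI] :
    {I : {set E} | (I \subset A) && indep M I & rk M A = #|I|}.
  by apply: eq_bigmax_cond; apply/card_gt0P; exists set0; rewrite unfold_in sub0set indep0.
move: (indI); rewrite maxI indepE => /eqP<-; apply/dimvS/vspan_subP=> e eA.
apply: contraT => eI; suff: (#|I|.+1 <= rk M A)%N by rewrite maxI ltnn.
have eI' : e \notin I by apply: contra eI; apply: mem_vspan.
rewrite -[#|I|.+1]/(true + #|I|)%N -eI' -cardsU1.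
by apply: leq_bigmax_cond; rewrite indepU1 // andbT subUset sub1set eA.
Qed.

Lemma mem_cl e (A : {set E}) : (e \in cl M A) = (v e \in vspan A).
Proof.
rewrite inE !rk_dim dim_vspanU1; case: (v e \in _); first exact: eqxx.
by rewrite add1n; apply/negP=> /eqP; lia.
Qed.

Lemma sub_cl (A : {set E}) : A \subset cl M A.
Proof. by apply/subsetP=> e eA; rewrite mem_cl mem_vspan. Qed.

Lemma vspan_cl (A : {set E}) : vspan (cl M A) = vspan A.
Proof.
apply/eqP; rewrite eqEsubv [X in _ && X]vspanS ?sub_cl // andbT.
by apply/vspan_subP=> e; rewrite mem_cl.
Qed.

Lemma flatP (F : {set E}) :
  reflect (forall e, v e \in vspan F -> e \in F) (is_flat M F).
Proof.
apply: (iffP eqP) => [eqF e|flatF]; first by rewrite -mem_cl eqF.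
apply/eqP; rewrite eqEsubset sub_cl andbT.
by apply/subsetP=> e; rewrite mem_cl; apply: flatF.
Qed.

Lemma cl_flat (A : {set E}) : is_flat M (cl M A).
Proof. by apply/flatP=> e; rewrite vspan_cl mem_cl. Qed.

Lemma flat_subset_rk (F G : {set E}) :
  is_flat M F -> F \subset G -> (rk M G <= rk M F)%N -> F = G.
Proof.
move=> /flatP flatF sFG; rewrite !rk_dim => le.
apply/eqP; rewrite eqEsubset sFG; apply/subsetP=> e eG; apply: flatF.
by apply: subvP (mem_vspan eG); rewrite -(dimv_leqif_sup (vspanS sFG)) eqn_leq dimvS ?vspanS.
Qed.

Lemma rk_le1 (A : {set E}) : simple_matroid M -> (rk M A <= 1)%N -> (#|A| <= 1)%N.
Proof.
move=> simpleM rkA; rewrite leqNgt; apply/negP=> /card_gt1P[e [f [eA fA ef]]].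
have : (2 <= rk M A)%N.
  have card2 : #|[set e; f]| = 2%N by rewrite cards2 ef.
  rewrite -card2; apply: leq_bigmax_cond.
  by rewrite subUset !sub1set eA fA simpleM // card2.
by rewrite leqNgt ltnS rkA.
Qed.

(** The dimension formula, with an inequality because the intersection of the spans may exceed the
    span of the intersection. *)
Lemma rk_submod (A B : {set E}) : (rk M (A :|: B) + rk M (A :&: B) <= rk M A + rk M B)%N.
Proof.
rewrite !rk_dim vspanU -(dimv_sum_cap (vspan A) (vspan B)) leq_add2l; apply: dimvS.
by rewrite subv_cap !vspanS ?subsetIl ?subsetIr.
Qed.

Lemma rk_cl (A : {set E}) : rk M (cl M A) = rk M A.
Proof. by rewrite !rk_dim vspan_cl. Qed.

Lemma rkS (A B : {set E}) : A \subset B -> (rk M A <= rk M B)%N.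
Proof. by move=> sAB; rewrite !rk_dim dimvS ?vspanS. Qed.

Lemma indep_rk (A : {set E}) : indep M A -> rk M A = #|A|.
Proof. by rewrite indepE -rk_dim => /eqP. Qed.

(** * From a chain of modular flats to a nice partition *)

Section ModularChain.

Variables (r : nat) (X : nat -> {set E}).
Hypothesis (simpleM : simple_matroid M).
Hypotheses (X0 : X 0%N = set0) (Xr : X r = [set: E]).
Hypothesis (XS : forall i, (i < r)%N -> X i \proper X i.+1).
Hypothesis (flatX : forall i, (i <= r)%N -> modular_flat M (X i)).
Hypothesis (rkX : forall i, (i <= r)%N -> rk M (X i) = i).

Let layer : {set {set E}} := [set X i.+1 :\: X (val i) | i : 'I_r].

Lemma chain_flat i : (i <= r)%N -> is_flat M (X i).
Proof. by move=> /flatX /andP[]. Qed.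

Lemma chainS i j : (i <= j)%N -> (j <= r)%N -> X i \subset X j.
Proof.
move=> /subnK <-; elim: (j - i)%N => // k IHk /=; rewrite addSn => lt.
by apply: subset_trans (IHk (ltnW lt)) (proper_sub (XS lt)).
Qed.

Lemma chain_layer e : exists2 i, (i < r)%N & e \in X i.+1 :\: X i.
Proof.
have ex : exists i, e \in X i by exists r; rewrite Xr.
have [[|i] eX mini] := ex_minnP ex; first by rewrite X0 inE in eX.
have ir : (i < r)%N by apply: mini; rewrite Xr.
by exists i; rewrite // inE eX andbT; apply/negP=> /mini; rewrite ltnn.
Qed.

Lemma chain_nice : nice M layer.
Proof.
split=> [T trT|F flatF F0].
  (* Climbing the chain preserves independence: the element of [T] in the next layer lies outside
     the flat [X k], which contains the earlier ones. *)
  suff ind k : (k <= r)%N -> indep M (T :&: X k).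
    by have := ind r (leqnn _); rewrite Xr setIT.
  elim: k => [|k IHk] kr; first by rewrite X0 setI0 indep0.
  have BP : X k.+1 :\: X k \in layer by apply/imsetP; exists (Ordinal kr).
  have /and3P[_ _ /forall_inP/(_ _ BP) /cards1P[t eqt]] := trT.
  have /setIP[tT /setDP[tX1 tX]] : t \in T :&: (X k.+1 :\: X k) by rewrite eqt set11.
  have -> : T :&: X k.+1 = t |: (T :&: X k).
    rewrite -[in LHS](setID (X k.+1) (X k)) (setIidPr (proper_sub (XS kr))).
    by rewrite setIUr eqt setUC.
  apply: indepU1; first exact: IHk (ltnW kr).
  apply: contra tX => tXk; have /flatP := chain_flat (ltnW kr); apply.
  by apply: subvP tXk; rewrite vspanS ?subsetIr.
have ex : exists i, X i :&: F != set0 by exists r; rewrite Xr setTI.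
have [[|i] XF mini] := ex_minnP ex; first by rewrite X0 set0I eqxx in XF.
have ir : (i < r)%N by apply: mini; rewrite Xr setTI.
have XiF : X i :&: F = set0.
  by apply/eqP; apply: contraT => /mini; rewrite ltnn.
have eqB : (X i.+1 :\: X i) :&: F = X i.+1 :&: F.
  by rewrite setIDAC; apply/setDidPl; rewrite -setI_eq0 -setIA [F :&: _]setIC XiF setI0.
exists (X i.+1 :&: F).
  rewrite !inE XF -eqB; apply/imsetP; exists (X i.+1 :\: X i) => //.
  by apply/imsetP; exists (Ordinal ir).
apply/eqP; rewrite eqn_leq card_gt0 XF andbT; apply: rk_le1 => //.
(* As [X i] misses [F], modularity gives their join rank [i + rk M F]. Submodularity for [X i.+1]
   and [F] then leaves rank at most one for the intersection. *)
have /andP[_ /forall_inP/(_ F flatF) /eqP] := flatX (ltnW ir).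
rewrite XiF rk_cl (rkX (ltnW ir)) [rk M set0]rk_dim vspan0 dimv0 add0n.
have := rk_submod (X i.+1) F; rewrite (rkX ir).
have := @rkS (X i :|: F) (X i.+1 :|: F) (setSU _ (proper_sub (XS ir))).
lia.
Qed.

(** Every rank occurs in the chain, and a flat comparable with the term of its own rank equals that
    term. *)
Lemma chain_maximal : maxset (modular_chain M) [set X (val i) | i : 'I_r.+1].
Proof.
have in_chain i : (i <= r)%N -> X i \in [set X (val i) | i : 'I_r.+1].
  by move=> ir; apply/imsetP; exists (inord i) => //; rewrite /= inordK.
have le_r (i : 'I_r.+1) : (val i <= r)%N by have := ltn_ord i.
apply/maxsetP; split=> [|C /andP[/forall_inP modC /forall_inP cmpC] subC].
  apply/andP; split; apply/forall_inP=> _ /imsetP[i _ ->]; first exact: flatX (le_r i).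
  apply/forall_inP=> _ /imsetP[j _ ->].
  by case/orP: (leq_total i j) => le; apply/orP; [left | right]; apply: chainS le _; rewrite le_r.
apply/eqP; rewrite eqEsubset subC andbT; apply/subsetP=> F FC.
have ir : (rk M F <= r)%N by rewrite -[r]rkX // Xr rkS ?subsetT.
have XC : X (rk M F) \in C by apply: (subsetP subC); apply: in_chain.
suff -> : F = X (rk M F) by apply: in_chain.
have /forall_inP/(_ _ XC)/orP[sFX|sXF] := cmpC F FC.
  by apply: flat_subset_rk; rewrite ?rkX //; case/andP: (modC F FC).
by symmetry; apply: flat_subset_rk; rewrite ?rkX // chain_flat.
Qed.

End ModularChain.

End Representation.

(** * From condition (2) to a chain of modular flats *)

Section Tower.

Local Open Scope ring_scope.

Variables (E : finType) (M : matroid E) (V : vectType 'F_2) (v : E -> V).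
Variable P : {set {set E}}.
Hypothesis indep_free : forall A : {set E}, indep M A = free [seq v e | e <- enum A].
Hypothesis simpleM : simple_matroid M.
Hypothesis partP : partition P [set: E].
Hypothesis indepP : independent_partition M P.
Hypothesis no_line : forall L B : {set E}, is_line M L -> B \in P -> ~~ (L \subset B).

Notation col := (pblock P).
Notation vspan := (vspan v).

Lemma pblock_partP (B : {set E}) e : B \in P -> (e \in B) = (pblock P e == B).
Proof.
case/and3P: partP => /eqP cov tiP _ BP; apply/idP/eqP => [eB|<-].
  exact: def_pblock.
by rewrite mem_pblock cov inE.
Qed.

Lemma pblock_in e : pblock P e \in P.
Proof. by case/and3P: partP => /eqP cov _ _; rewrite pblock_mem ?cov ?inE. Qed.

Lemma mem_pblockE e f : (f \in pblock P e) = (pblock P f == pblock P e).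
Proof. by rewrite pblock_partP ?pblock_in. Qed.

(** A rainbow set grows to a full transversal by one element from each block that it misses. *)
Lemma rainbow_indep (T : {set E}) : rainbow col T -> indep M T.
Proof.
move=> rT.
have [S [sS rS colS]] := rainbow_transversal col [set e | col e \notin col @: T].
apply: (@indepS _ M T (T :|: S)); first exact: subsetUl.
apply: indepP; apply/and3P; split=> //.
have disj x y : x \in T -> y \in S -> col x != col y.
  move=> xT /(subsetP sS); rewrite inE; apply: contraNneq => <-.
  exact: imset_f.
apply/forall_inP=> B BP.
have [e eB] : exists e, e \in B.
  by apply/set0Pn; apply: contraTneq BP => ->; case/and3P: partP.
move: eB; rewrite (pblock_partP _ BP) => /eqP eqB.
have [x xTS xB] : exists2 x, x \in T :|: S & col x = B.
  have [/imsetP[x xT ex]|eT] := boolP (col e \in col @: T).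
    by exists x; rewrite ?inE ?xT // -ex.
  have : col e \in col @: S by rewrite colS imset_f // inE.
  by case/imsetP=> x xS ex; exists x; rewrite ?inE ?xS ?orbT // -ex.
apply/cards1P; exists x; apply/setP=> y; rewrite !inE (pblock_partP _ BP) -xB.
apply/andP/eqP => [[yTS /eqP cyx]|->]; last by move: xTS; rewrite inE.
move: yTS xTS; rewrite inE => /orP[yT|yS] /orP[xT|xS].
- exact: rT.
- by have := disj _ _ yT xS; rewrite cyx eqxx.
- by have := disj _ _ xT yS; rewrite cyx eqxx.
- exact: rS.
Qed.

Lemma rainbow_notin_vspan e (T : {set E}) :
  rainbow col T -> col e \notin col @: T -> v e \notin vspan T.
Proof.
move=> rT eT; have := rainbow_indep (rainbowU1 rT eT); have := rainbow_indep rT.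
rewrite !(indepE indep_free) dim_vspanU1 cardsU1 (notin_imset_notin eT) => /eqP->.
by rewrite eqn_add2r; case: (_ \notin _).
Qed.

Lemma rainbow_sum_neq0 (T : {set E}) :
  rainbow col T -> T != set0 -> \sum_(e in T) v e != 0.
Proof.
move=> rT /set0Pn[e eT]; have rT' : rainbow col (T :\ e) by apply: rainbowS rT; apply: subD1set.
have eT' : col e \notin col @: (T :\ e).
  apply/imsetP=> [[f /setD1P[fe fT] /(rT _ _ eT fT) ef]].
  by rewrite ef eqxx in fe.
apply: contraNneq (rainbow_notin_vspan rT' eT').
rewrite (big_setD1 e) //= => /eqP; rewrite addr_eq0 => /eqP->.
by rewrite memvN memv_suml // => f fT; apply: mem_vspan.
Qed.

Lemma F2_cases (k : 'F_2) : k = 0 \/ k = 1.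
Proof. by case: k => [[|[|[]]]] // lt; [left | right]; apply: val_inj. Qed.

Lemma add2_F2 (x : V) : x + x = 0.
Proof. by rewrite -mulr2n -scaler_nat (_ : 2%:R = 0) ?scale0r //; apply: val_inj. Qed.

Lemma simple_inj e f : v e = v f -> e = f.
Proof.
move=> eq_v; apply/eqP; apply: contraT => ef; have := simpleM (A := [set e; f]).
rewrite cards2 ef (indepE indep_free) cards2 ef => /(_ isT).
rewrite dim_vspanU1 vspan1 eq_v memv_line dim_vline; by case: (_ != _).
Qed.

(** The line through [e] and [f] leaves their block at some [g]. Over F_2 its vector is zero, [v e],
    [v f] or their sum, and only the sum is possible. *)
Lemma third_point_line e f : e != f -> col e = col f ->
  exists2 g, v g = v e + v f & col g != col e.
Proof.
move=> ef cef; pose L := cl M [set e; f].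
have ind : indep M [set e; f] by apply: simpleM; rewrite cards2 ef.
have lineL : is_line M L.
  rewrite /is_line (cl_flat indep_free) (rk_cl indep_free).
  by rewrite (indep_rk indep_free) // cards2 ef.
have /subsetPn[g gL gB] := no_line lineL (pblock_in e).
rewrite mem_pblockE in gB; exists g => //.
move: gL; rewrite (mem_cl indep_free) vspanU !vspan1.
case/memv_addP=> _ /vlineP[k ->] [_ /vlineP[l ->]].
have ge : v g != v e by apply: contraNneq gB => /simple_inj->.
have gf : v g != v f by apply: contraNneq gB => /simple_inj->; rewrite cef.
have g0 : v g != 0.
  have := rainbow_sum_neq0 (T := [set g]); rewrite big_set1; apply.
    by move=> x y /set1P-> /set1P->.
  by apply/set0Pn; exists g; rewrite set11.
case: (F2_cases k) (F2_cases l) => -> [] ->; rewrite ?scale0r ?scale1r ?add0r ?addr0 => // vg.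
- by rewrite vg eqxx in g0.
- by rewrite vg eqxx in gf.
- by rewrite vg eqxx in ge.
Qed.

(** Made total by standing still when no block is addable; by [tower_extend] this never happens at a
    stage short of the ground set. *)
Definition extend (X : {set E}) : {set E} :=
  if [pick e | addable v col X e] is Some e then X :|: pblock P e else X.

Definition tower (k : nat) : {set E} := iter k extend set0.

Lemma extendP (X : {set E}) :
  extend X = X \/ exists2 e, addable v col X e & extend X = X :|: pblock P e.
Proof. by rewrite /extend; case: pickP => [e|]; [right; exists e | left]. Qed.

Lemma tower_succ k : tower k.+1 = extend (tower k).
Proof. by []. Qed.

Lemma towerS k : tower k \subset tower k.+1.
Proof. by rewrite tower_succ; case: (extendP (tower k)) => [->|[e _ ->]] //; apply: subsetUl. Qed.

Lemma tower_saturated k e f : e \in tower k -> col e = col f -> f \in tower k.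
Proof.
elim: k => [|k IHk]; first by rewrite inE.
rewrite tower_succ; case: (extendP (tower k)) => [->|[g _ ->]] //.
rewrite !inE !mem_pblockE => /orP[eX|eg] ef; first by rewrite IHk.
by rewrite -ef eg orbT.
Qed.

(** One representative per block suffices: two elements of [Y] in the block just added differ by an
    element of the previous stage, which lies in [Y] because [Y] is a flat. This turns ranks into
    counts of blocks. *)
Lemma vspan_tower (Y T : {set E}) k : is_flat M Y -> T \subset Y -> col @: T = col @: Y ->
  vspan (Y :&: tower k) = vspan (T :&: tower k).
Proof.
move=> /(flatP indep_free) flatY sTY colTY.
apply/eqP; rewrite eqEsubv [X in _ && X]vspanS ?setSI // andbT.
elim: k => [|k IHk]; first by rewrite /= !setI0.
rewrite tower_succ; case: (extendP (tower k)) => [->|[e addX ->]] //.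
have sub : (vspan (Y :&: tower k) <= vspan (T :&: (tower k :|: pblock P e)))%VS.
  by apply: subv_trans IHk _; rewrite vspanS ?setIS ?subsetUl.
apply/vspan_subP=> f; rewrite !inE mem_pblockE => /andP[fY /orP[fX|/eqP fe]].
  by apply: (subvP sub); rewrite mem_vspan // inE fY.
have : col f \in col @: T by rewrite colTY imset_f.
case/imsetP=> t tT ft.
have tX : v t \in vspan (T :&: (tower k :|: pblock P e)).
  by rewrite mem_vspan // !inE tT mem_pblockE -ft fe eqxx orbT.
have [->//|neq] := eqVneq f t.
have /andP[_ /forallP/(_ f)/forallP/(_ t)] := addX.
rewrite fe -ft fe eqxx neq /= => /exists_inP[g gX /eqP vg].
have vf : v f = v g + v t by rewrite vg -addrA add2_F2 addr0.
rewrite vf memvD //; apply: (subvP sub); rewrite mem_vspan // inE gX andbT.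
apply: flatY; rewrite vg memvD // mem_vspan //; exact: (subsetP sTY).
Qed.

Lemma flatT : is_flat M [set: E].
Proof. by apply/(flatP indep_free)=> e _; rewrite inE. Qed.

(** A stage is spanned by a rainbow set, and an element outside it has a new color, hence lies
    outside the span. *)
Lemma tower_flat k : is_flat M (tower k).
Proof.
have [T [sT rT colT]] := rainbow_transversal col [set: E].
apply/(flatP indep_free)=> e; rewrite -{1}[tower k]setTI (vspan_tower k flatT sT colT).
apply: contraTT => eX; apply: rainbow_notin_vspan.
  by apply: rainbowS rT; apply: subsetIl.
apply/imsetP=> [[f /setIP[_ fX] /esym]] /(tower_saturated fX) eX'.
by rewrite eX' in eX.
Qed.

Lemma tower_extend k : tower k != [set: E] ->
  exists2 e, e \notin tower k & tower k.+1 = tower k :|: pblock P e.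
Proof.
move=> XT; have [||e] := exists_addable add2_F2 rainbow_sum_neq0 third_point_line _ _ XT.
- exact: tower_saturated.
- move=> e f g eX fX vg; have /(flatP indep_free) := tower_flat k; apply.
  by rewrite vg memvD ?mem_vspan.
move=> adde; rewrite tower_succ /extend.
case: pickP => [f|/(_ e)]; last by rewrite adde.
by case/andP=> fX _; exists f.
Qed.

Lemma rk_tower_transversal (T : {set E}) k : rainbow col T -> col @: T = col @: [set: E] ->
  rk M (tower k) = #|T :&: tower k|.
Proof.
move=> rT colT; rewrite (rk_dim indep_free) -{1}[tower k]setTI.
rewrite (vspan_tower k flatT (subsetT T) colT); apply/eqP; rewrite -(indepE indep_free).
by apply: rainbow_indep; apply: rainbowS rT; apply: subsetIl.
Qed.

Lemma rk_tower k : (k <= rk M [set: E])%N -> rk M (tower k) = k.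
Proof.
have [T [sT rT colT]] := rainbow_transversal col [set: E].
have rkE := rk_tower_transversal _ rT colT.
elim: k => [|k IHk] kr; first by rewrite rkE setI0 cards0.
have rkk := IHk (ltnW kr).
have [|e eX eqX] := @tower_extend k.
  by apply/eqP=> eqT; rewrite -eqT rkk ltnn in kr.
have : col e \in col @: T by rewrite colT imset_f.
case/imsetP=> t tT et; rewrite rkE eqX.
have -> : T :&: (tower k :|: pblock P e) = t |: (T :&: tower k).
  apply/setP=> x; rewrite !inE mem_pblockE et; case: (eqVneq x t) => [->|xt] /=.
    by rewrite tT eqxx orbT.
  case xT: (x \in T) => //=; case: eqP => [/(rT _ _ xT tT) xt'|_]; last by rewrite orbF.
  by rewrite xt' eqxx in xt.
rewrite cardsU1 -rkE rkk inE tT /=.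
by rewrite (contra (fun tX => tower_saturated tX (esym et)) eX).
Qed.

Lemma tower_rk : tower (rk M [set: E]) = [set: E].
Proof. by apply: (flat_subset_rk indep_free); rewrite ?tower_flat ?subsetT ?rk_tower. Qed.

Lemma tower_modular k : modular_flat M (tower k).
Proof.
rewrite /modular_flat tower_flat; apply/forall_inP=> Y flatY.
have [S [sS rS colS]] := rainbow_transversal col [set: E].
have [T [sT rT colT]] := rainbow_transversal col Y.
have rk_rainbow U : rainbow col U -> rk M U = #|U|.
  by move=> rU; rewrite (indep_rk indep_free) // rainbow_indep.
have rkYX j : rk M (Y :&: tower j) = #|T :&: tower j|.
  rewrite (rk_dim indep_free) (vspan_tower j flatY sT colT) -(rk_dim indep_free).
  by apply: rk_rainbow; apply: rainbowS rT; apply: subsetIl.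
have rkY : rk M Y = #|T|.
  by have := rkYX (rk M [set: E]); rewrite tower_rk !setIT.
(* Representatives of the blocks of the stage, together with those of the other blocks met by [Y],
   bound the rank of the join from below; submodularity gives the matching upper bound. *)
have rXY : rainbow col ((S :&: tower k) :|: (T :\: tower k)).
  move=> x y /setUP[/setIP[xS xX]|/setDP[xT xX]] /setUP[/setIP[yS yX]|/setDP[yT yX]] eq_xy.
  - exact: rS.
  - by rewrite (tower_saturated xX eq_xy) in yX.
  - by rewrite (tower_saturated yX (esym eq_xy)) in xX.
  - exact: rT.
have cardXY : #|(S :&: tower k) :|: (T :\: tower k)| = (#|S :&: tower k| + #|T :\: tower k|)%N.
  have dis : (S :&: tower k) :&: (T :\: tower k) = set0.
    by apply/setP=> x; rewrite !inE; case: (x \in tower k); rewrite ?andbF.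
  by rewrite cardsU dis cards0 subn0.
have low : (#|S :&: tower k| + #|T :\: tower k| <= rk M (tower k :|: Y))%N.
  rewrite -cardXY -rk_rainbow // (rkS indep_free) //.
  by rewrite setUSS ?subsetIr // (subset_trans (subsetDl _ _)).
have up := rk_submod indep_free (tower k) Y.
have cardT := cardsID (tower k) T.
rewrite /modular_pair (rk_cl indep_free); rewrite setIC rkYX in up *.
rewrite (rk_tower_transversal k rS colS) rkY in up *.
apply/eqP; lia.
Qed.

Lemma tower_proper k : (k < rk M [set: E])%N -> tower k \proper tower k.+1.
Proof.
move=> kr; rewrite properE towerS; apply/negP=> /(rkS indep_free).
by rewrite !rk_tower ?ltnn // ltnW.
Qed.

Lemma tower_layers : P = [set tower i.+1 :\: tower (val i) | i : 'I_(rk M [set: E])].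
Proof.
have layer k : (k < rk M [set: E])%N ->
    exists2 e, e \notin tower k & tower k.+1 :\: tower k = pblock P e.
  move=> kr; have [|e eX ->] := @tower_extend k.
    by apply/eqP=> eqT; move: (kr); rewrite -eqT rk_tower ?ltnn // ltnW.
  exists e => //; rewrite setDUl setDv set0U; apply/setDidPl.
  rewrite -setI_eq0; apply/eqP/setP=> x; rewrite !inE mem_pblockE.
  by apply/andP=> [[/eqP /esym xe]] /tower_saturated /(_ (esym xe)); apply/negP.
apply/setP=> B; apply/idP/imsetP => [BP|[i _ ->]]; last first.
  by have [e _ ->] := layer i (ltn_ord i); apply: pblock_in.
have [e eB] : exists e, e \in B.
  by apply/set0Pn; apply: contraTneq BP => ->; case/and3P: partP.
have [i ir eX] := @chain_layer _ _ _ (erefl : tower 0 = set0) tower_rk e.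
exists (Ordinal ir) => //=; have [f _ eqf] := layer i ir.
move: eX; rewrite eqf pblock_partP ?pblock_in // => /eqP <-.
by move: eB; rewrite pblock_partP // => /eqP.
Qed.

End Tower.

(** * The cycle of implications *)

Theorem theorem1p2 (E : finType) (M : matroid E) (r : nat) (P : {set {set E}})
    (hsimple : simple_matroid M) (hbinary : binary M)
    (hr : rk M [set: E] = r) (hr0 : 0 < r)
    (hP : partition P [set: E]) :
  [<-> nice M P;
       independent_partition M P /\
       (forall L B : {set E}, is_line M L -> B \in P -> ~~ (L \subset B));
       exists X : nat -> {set E},
         [/\ maximal_modular_chain M r X,
             (forall i, i <= r -> rk M (X i) = i) &
             P = [set X i.+1 :\: X (val i) | i : 'I_r]]].
Proof.
have [n [v indep_free]] := hbinary.
tfae.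
(* A line inside a block is the only block of its own induced partition, so niceness would make it a
   singleton, of rank at most one. *)
- case=> indepP niceP; split=> // L B /andP[flatL /eqP rkL] BP; apply/negP=> sLB.
  have L0 : L != set0.
    by apply: contra_eqN rkL => /eqP->; rewrite (rk_dim indep_free) vspan0 dimv0.
  have [A] := niceP L flatL L0; rewrite !inE => /andP[A0 /imsetP[B' B'P eqA]] cardA.
  have /set0Pn[e] := A0; rewrite eqA => /setIP[eB' /(subsetP sLB) eB].
  have eqB : B' = B.
    move: eB' eB; rewrite (pblock_partP hP _ B'P) (pblock_partP hP _ BP).
    by move=> /eqP <- /eqP.
  have /cards1P[x eqL] : #|L| == 1 by rewrite -cardA eqA eqB (setIidPr sLB).
  move: rkL; rewrite eqL (rk_dim indep_free) vspan1 dim_vline.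
  by case: (v x != _).
- case=> indepP no_line; exists (tower v P); rewrite -hr.
  have flats i : i <= rk M [set: E] -> modular_flat M (tower v P i).
    by move=> _; apply: tower_modular.
  have ranks i : i <= rk M [set: E] -> rk M (tower v P i) = i by apply: rk_tower.
  have strict i : i < rk M [set: E] -> tower v P i \proper tower v P i.+1.
    exact: tower_proper.
  split=> //; last exact: tower_layers.
  by split=> //; [apply: tower_rk | apply: chain_maximal => //; apply: tower_rk].
- case=> X [[X0 Xr XS modX _] rkX ->].
  exact: (chain_nice indep_free).
Qed.
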